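(* Let $K$ be a compact convex body in the hyperbolic plane and let $d>0$. If $K$ is a body of constant diameter $d$, then $K$ is a body of constant width $d$, i.e. $\mathrm{width}_K(X)=d$ for every ideal point $X\in\mathcal I$.
   Context: The hyperbolic plane has curvature $-1$; $\mathcal I$ denotes the set of its ideal points (the boundary circle in a disk model). A compact convex body is a compact convex set with nonempty interior. For distinct $X,Y\in\mathcal I$, $YX$ denotes the hyperbolic line with ideal endpoints $Y$ and $X$. If $YX$ meets $K$, there are two hypercycles (distance curves) with leading line $YX$, one on each side of it (possibly degenerating to $YX$ itself), which touch $K$ and such that the strip between them contains $K$. Let $d_K^+(YX)$ and $d_K^-(YX)$ be the distances of these two hypercycles from $YX$; that is, $d_K^{\pm}(YX)$ is the maximal distance from $YX$ of a point of $K$ in the respective closed half-plane bounded by $YX$. Put $d_K(YX)=d_K^+(YX)+d_K^-(YX)$. The width of $K$ in the direction $X\in\mathcal I$ is $$\mathrm{width}_K(X)=\sup\{d_K(YX): Y\in\mathcal I\setminus\{X\},\ YX\cap K\neq\emptyset\}.$$ $K$ has constant width $\lambda>0$ if $\mathrm{width}_K(X)=\lambda$ for every $X\in\mathcal I$. $K$ is of constant diameter $d$ if its diameter (the greatest distance between two of its points) is $d$ and each boundary point of $K$ is an endpoint of a chord of $K$ of length $d$. *)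

(* Defs.v *)
From HB Require Import structures.
From mathcomp Require Import all_boot all_order all_algebra.
From mathcomp Require Import all_classical all_reals all_analysis.

Set Implicit Arguments.
Unset Strict Implicit.
Unset Printing Implicit Defensive.

Import Order.TTheory GRing.Theory Num.Theory.
Import numFieldNormedType.Exports.

Local Open Scope classical_set_scope.
Local Open Scope ring_scope.

(* The hyperbolic plane of curvature -1 is the Beltrami-Klein model: its points
   are those of the open unit disk of R^2, its topology is the Euclidean one,
   its ideal points form the unit circle, and its lines and segments are the
   open chords of the disk and the Euclidean segments.

   Every [sup] and [inf] below is taken of a nonempty bounded set of reals when
   K is a compact convex body and the line YX meets K, so the default value 0
   of the library operators never occurs in the intended use. *)

Definition dot (R : realType) (p q : R * R) : R := p.1 * q.1 + p.2 * q.2.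

Definition hplane (R : realType) : set (R * R) := [set p | dot p p < 1].

Definition ideal (R : realType) : set (R * R) := [set X | dot X X = 1].

Definition arcosh (R : realType) (x : R) : R := ln (x + Num.sqrt (x ^+ 2 - 1)).

(* The distance of the Klein model in curvature -1:
   cosh (hdist p q) = (1 - <p,q>) / sqrt ((1 - |p|^2) (1 - |q|^2)). *)
Definition hdist (R : realType) (p q : R * R) : R :=
  arcosh ((1 - dot p q) / Num.sqrt ((1 - dot p p) * (1 - dot q q))).

(* The sign of the determinant det(X - Y, p - Y) tells on which side of the
   chord from Y to X the point p lies. *)
Definition side (R : realType) (Y X p : R * R) : R :=
  (X.1 - Y.1) * (p.2 - Y.2) - (X.2 - Y.2) * (p.1 - Y.1).

Definition hline (R : realType) (Y X : R * R) : set (R * R) :=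
  [set p | hplane p /\ side Y X p = 0].

Definition halfplane_plus (R : realType) (Y X : R * R) : set (R * R) :=
  [set p | hplane p /\ 0 <= side Y X p].

Definition halfplane_minus (R : realType) (Y X : R * R) : set (R * R) :=
  [set p | hplane p /\ side Y X p <= 0].

Definition dist_to (R : realType) (L : set (R * R)) (p : R * R) : R :=
  inf [set hdist p q | q in L].

Definition d_plus (R : realType) (K : set (R * R)) (Y X : R * R) : R :=
  sup [set dist_to (hline Y X) p | p in K `&` halfplane_plus Y X].

Definition d_minus (R : realType) (K : set (R * R)) (Y X : R * R) : R :=
  sup [set dist_to (hline Y X) p | p in K `&` halfplane_minus Y X].

Definition d_strip (R : realType) (K : set (R * R)) (Y X : R * R) : R :=
  d_plus K Y X + d_minus K Y X.

Definition width (R : realType) (K : set (R * R)) (X : R * R) : R :=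
  sup [set d_strip K Y X |
       Y in [set Y | [/\ ideal Y, Y <> X & hline Y X `&` K !=set0]]].

Definition constant_width (R : realType) (K : set (R * R)) (w : R) : Prop :=
  forall X, ideal X -> width K X = w.

(* Geodesic segments being Euclidean segments, hyperbolic convexity of a subset
   of the disk is [convex_set]; the disk being open in R^2, compactness,
   interior and closure of a compact subset may be taken in R^2. *)
Definition convex_body (R : realType) (K : set (R * R)) : Prop :=
  [/\ K `<=` @hplane R, compact K, convex_set K & interior K !=set0].

Definition bd (R : realType) (K : set (R * R)) : set (R * R) :=
  closure K `\` interior K.

Definition diameter (R : realType) (K : set (R * R)) : R :=
  sup [set hdist p.1 p.2 | p in K `*` K].

(* A chord of K is a segment joining two boundary points. *)
Definition constant_diameter (R : realType) (K : set (R * R)) (d : R) : Prop :=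
  diameter K = d /\
  forall p, bd K p -> exists2 q, bd K q & hdist p q = d.

(* Main.v *)
(* Let C = cosh d, and lift the disk to the hyperboloid <u,u> = 1 of Minkowski
   space, so that cosh of the distance is <P,Q>. If p in K and q in K lie on
   opposite sides of a line, the segment pq crosses it, so d_strip <= d for
   every line. For the converse, fix X and let p be a point of K on a line
   through X supporting K. Points of this line are not interior to K, hence each
   of them is at distance at least d from some point of K; moving from p towards
   X and away from X gives in the limit q1, q2 in K at distance d from p with
   <q2,X> <= C <p,X> <= <q1,X>. On the arc from q1 to q2 of the circle of radius
   d about p there is r with <r,X> = C <p,X>, which says that pr is orthogonal
   to the line pX. As K contains every point at distance at most d from all its
   points, r is in K, and r is at distance d from the line pX. *)

Require Import Defs.
From mathcomp Require Import all_boot all_order all_algebra.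
From mathcomp Require Import all_classical all_reals all_analysis.
From mathcomp Require Import ring lra.
Import Order.TTheory GRing.Theory Num.Theory.
Import numFieldNormedType.Exports.
Local Open Scope classical_set_scope.
Local Open Scope ring_scope.

Set Implicit Arguments.
Unset Strict Implicit.
Unset Printing Implicit Defensive.

(** * The Minkowski form and the lift of the Klein disk to the hyperboloid *)

Section Minkowski.
Variable R : realType.
Implicit Types (u v w : R * R * R) (p q z X : R * R) (a b t : R).

Definition mdot u v := u.1.1 * v.1.1 - u.1.2 * v.1.2 - u.2 * v.2.

Definition lin a u b v : R * R * R :=
  (a * u.1.1 + b * v.1.1, a * u.1.2 + b * v.1.2, a * u.2 + b * v.2).

Definition hyperboloid u := mdot u u = 1 /\ 0 < u.1.1.

(** The unnormalized lift, available on the boundary circle as well: an ideal point becomes a null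
    vector. *)
Definition homog p : R * R * R := (1, p.1, p.2).

Definition hlift p : R * R * R :=
  let w := (Num.sqrt (1 - dot p p))^-1 in (w, w * p.1, w * p.2).

Definition hproj u : R * R := (u.1.2 / u.1.1, u.2 / u.1.1).

Lemma mdotC u v : mdot u v = mdot v u.
Proof. rewrite /mdot; ring. Qed.

Lemma mdot_linl a u b v w : mdot (lin a u b v) w = a * mdot u w + b * mdot v w.
Proof. rewrite /mdot /=; ring. Qed.

Lemma mdot_linr a u b v w : mdot w (lin a u b v) = a * mdot w u + b * mdot w v.
Proof. by rewrite mdotC mdot_linl !(mdotC w). Qed.

Definition mdotE := (mdot_linl, mdot_linr).

Lemma mdot_homog p q : mdot (homog p) (homog q) = 1 - dot p q.
Proof. rewrite /mdot /dot /=; ring. Qed.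

(** Reversed Cauchy-Schwarz inequality. By Lagrange's identity the square of [u0 * v0] exceeds that
    of [1 + u1 * v1 + u2 * v2] by a sum of squares which vanishes only if the space coordinates
    agree. *)
Lemma hyperboloid_mdot_gt1 u v : hyperboloid u -> hyperboloid v -> u <> v ->
  1 < mdot u v.
Proof.
case: u v => [[u0 u1] u2] [[v0 v1] v2] [+ /= u0_gt0] [+ /= v0_gt0] uv.
rewrite /mdot /= => uu vv.
have e : (u0 * v0) ^+ 2 = (1 + u1 * v1 + u2 * v2) ^+ 2 + (u1 - v1) ^+ 2
   + (u2 - v2) ^+ 2 + (u1 * v2 - u2 * v1) ^+ 2.
  have -> : (u0 * v0) ^+ 2 = (u0 * u0) * (v0 * v0) by ring.
  have -> : u0 * u0 = 1 + u1 * u1 + u2 * u2 by lra.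
  have -> : v0 * v0 = 1 + v1 * v1 + v2 * v2 by lra.
  ring.
have pos : 0 < u0 * v0 by rewrite mulr_gt0.
rewrite ltNge; apply/negP => le1.
have le2 : (u0 * v0) ^+ 2 <= (1 + u1 * v1 + u2 * v2) ^+ 2.
  by rewrite ler_sqr ?nnegrE; lra.
have s1 := sqr_ge0 (u1 - v1); have s2 := sqr_ge0 (u2 - v2).
have s3 := sqr_ge0 (u1 * v2 - u2 * v1).
have /eqP : (u1 - v1) ^+ 2 = 0 by lra.
rewrite sqrf_eq0 subr_eq0 => /eqP e1.
have /eqP : (u2 - v2) ^+ 2 = 0 by lra.
rewrite sqrf_eq0 subr_eq0 => /eqP e2.
apply: uv; subst; congr (_, _, _).
by apply/eqP; rewrite -(@eqrXn2 _ 2) // ?ltW //; apply/eqP; lra.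
Qed.

Lemma hyperboloid_mdot_ge1 u v : hyperboloid u -> hyperboloid v -> 1 <= mdot u v.
Proof.
move=> hu hv; have [->|/eqP uv] := eqVneq u v; first by rewrite hv.1.
exact/ltW/hyperboloid_mdot_gt1.
Qed.

(** By Cauchy-Schwarz for the space coordinates, a timelike vector outside the future cone cannot
    have a positive product with [u]. This places linear combinations on the upper sheet. *)
Lemma future u v : hyperboloid u -> 0 < mdot v v -> 0 < mdot u v -> 0 < v.1.1.
Proof.
case: u v => [[u0 u1] u2] [[v0 v1] v2] [+ /= u0_gt0].
rewrite /mdot /= => uu vv uv.
rewrite ltNge; apply/negP => v0_le0.
have h1 : u0 * v0 <= 0 by rewrite mulr_ge0_le0 // ltW.
have : (u0 * v0) ^+ 2 <= (u1 * v1 + u2 * v2) ^+ 2.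
  by rewrite -[leLHS]sqrrN -[leRHS]sqrrN ler_sqr ?nnegrE; lra.
apply/negP; rewrite -ltNge.
have -> : (u0 * v0) ^+ 2 = (u0 * u0) * (v0 * v0) by ring.
have -> : u0 * u0 = 1 + u1 * u1 + u2 * u2 by lra.
have h2 : v1 * v1 + v2 * v2 < v0 * v0 by lra.
have h3 : (u1 * u1 + u2 * u2) * (v1 * v1 + v2 * v2) <=
  (u1 * u1 + u2 * u2) * (v0 * v0).
  by rewrite ler_wpM2l ?(ltW h2) // addr_ge0 // -expr2 sqr_ge0.
have := sqr_ge0 (u1 * v2 - u2 * v1).
have := sqr_ge0 v1; have := sqr_ge0 v2.
by nra.
Qed.

Lemma hplane_gt0 p : hplane p -> 0 < 1 - dot p p.
Proof. by rewrite /hplane /= subr_gt0. Qed.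

Lemma sqrt_hplane_gt0 p : hplane p -> 0 < Num.sqrt (1 - dot p p).
Proof. by rewrite sqrtr_gt0; exact: hplane_gt0. Qed.

Lemma mdot_hlift p u :
  mdot (hlift p) u = (Num.sqrt (1 - dot p p))^-1 * mdot (homog p) u.
Proof. rewrite /mdot /=; ring. Qed.

Lemma hyperboloid_hlift p : hplane p -> hyperboloid (hlift p).
Proof.
move=> hp; split; last by rewrite /= invr_gt0 sqrt_hplane_gt0.
rewrite mdot_hlift mdotC mdot_hlift mdot_homog.
rewrite -[X in _ * (_ * X)]sqr_sqrtr ?ltW ?hplane_gt0 //.
have := sqrt_hplane_gt0 hp; set s := Num.sqrt _ => s0.
by field; rewrite gt_eqF.
Qed.

Lemma hplane_hproj u : hyperboloid u -> hplane (hproj u).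
Proof.
case: u => [[u0 u1] u2] [+ /= u0_gt0]; rewrite /mdot /hplane /dot /= => uu.
have -> : u1 / u0 * (u1 / u0) + u2 / u0 * (u2 / u0) =
    (u1 * u1 + u2 * u2) / (u0 * u0) by field; rewrite gt_eqF.
by rewrite ltr_pdivrMr ?mulr_gt0 //; lra.
Qed.

Lemma hlift_hproj u : hyperboloid u -> hlift (hproj u) = u.
Proof.
move=> hu; case: hu (hplane_hproj hu).
case: u => [[u0 u1] u2]; rewrite /mdot /hplane /hlift /lin /dot /= => uu u0_gt0 _.
have -> : 1 - (u1 / u0 * (u1 / u0) + u2 / u0 * (u2 / u0)) = u0^-1 ^+ 2.
  apply/eqP; rewrite -subr_eq0; apply/eqP.
  rewrite (_ : _ - _ = (u0 * u0 - u1 * u1 - u2 * u2 - 1) / u0 ^+ 2).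
    by rewrite uu subrr mul0r.
  by field; rewrite gt_eqF.
rewrite sqrtr_sqr ger0_norm ?invr_ge0 ?ltW // invrK.
by congr (_, _, _); field; rewrite ?gt_eqF.
Qed.

Lemma hproj_hlift p : hplane p -> hproj (hlift p) = p.
Proof.
move=> /sqrt_hplane_gt0; case: p => p1 p2; rewrite /hproj /=.
by set s := Num.sqrt _ => s0; congr (_, _); field; rewrite gt_eqF.
Qed.

Lemma hlift_inj p q : hplane p -> hplane q -> hlift p = hlift q -> p = q.
Proof. by move=> hp hq e; rewrite -(hproj_hlift hp) e hproj_hlift. Qed.

Lemma hyperboloid_unit u v : hyperboloid u -> 0 < mdot v v -> 0 < mdot u v ->
  hyperboloid (lin (Num.sqrt (mdot v v))^-1 v 0 v).
Proof.
move=> hu vv uv; have v0 := future hu vv uv.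
have s0 : 0 < Num.sqrt (mdot v v) by rewrite sqrtr_gt0.
split; last by rewrite /= mul0r addr0 mulr_gt0 // invr_gt0.
rewrite !mdotE !mul0r !addr0 -[X in _ * (_ * X)]sqr_sqrtr ?ltW //.
by field; rewrite gt_eqF.
Qed.

Lemma hplane_conv p q t : hplane p -> hplane q -> 0 <= t <= 1 ->
  hplane ((1 - t) * p.1 + t * q.1, (1 - t) * p.2 + t * q.2).
Proof.
rewrite /hplane /dot; case: p q => [p1 p2] [q1 q2] /= hp hq /andP[t0 t1].
(* The combination z satisfies 1 - |z|^2 = (1-t)(1-|p|^2) + t(1-|q|^2) + t(1-t)|p-q|^2. *)
have := mulr_ge0 (mulr_ge0 t0 (_ : 0 <= 1 - t))
  (addr_ge0 (sqr_ge0 (p1 - q1)) (sqr_ge0 (p2 - q2))).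
rewrite subr_ge0 => /(_ t1).
set d1 := (p1 * p1 + p2 * p2) in hp *; set d2 := (q1 * q1 + q2 * q2) in hq *.
have : 0 < (1 - t) * (1 - d1) + t * (1 - d2).
  move: t1; rewrite le_eqVlt => /orP[/eqP ->|t1]; first lra.
  by rewrite ltr_pwDl ?mulr_gt0 ?mulr_ge0 ?subr_gt0 ?subr_ge0 // ltW.
by rewrite /d1 /d2; lra.
Qed.

(** [homog] is affine and [hlift] is a positive multiple of it, so Euclidean segments lift to
    nonnegative combinations; the coefficients absorb the normalizations. *)
Lemma hlift_conv p q t (z := ((1 - t) * p.1 + t * q.1, (1 - t) * p.2 + t * q.2)) :
  hplane p -> hplane q -> hplane z ->
  hlift z = lin ((1 - t) * Num.sqrt (1 - dot p p) / Num.sqrt (1 - dot z z)) (hlift p)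
    (t * Num.sqrt (1 - dot q q) / Num.sqrt (1 - dot z z)) (hlift q).
Proof.
move=> /sqrt_hplane_gt0 hp /sqrt_hplane_gt0 hq /sqrt_hplane_gt0 hz; rewrite /hlift /lin /=.
by congr (_, _, _); field; rewrite !gt_eqF.
Qed.

(** Twice the product is |p - X|^2 + (1 - |p|^2). *)
Lemma mdot_ideal p X : hplane p -> ideal X -> 0 < mdot (homog p) (homog X).
Proof.
rewrite mdot_homog /hplane /ideal /dot; case: p X => [p1 p2] [x1 x2] /= hp hX.
have := sqr_ge0 (p1 - x1); have := sqr_ge0 (p2 - x2); nra.
Qed.

(** * Hyperbolic cosine, distance and its additivity along segments *)

Definition cosh t : R := (expR t + expR (- t)) / 2.

Lemma cosh_gt1 t : 0 < t -> 1 < cosh t.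
Proof.
move=> t0; rewrite /cosh expRN.
have := expR_gt1 t; rewrite t0; move: (expR t) => e e1.
have e0 : 0 < e by lra.
rewrite -subr_gt0 (_ : _ - _ = (e - 1) ^+ 2 / (2 * e)).
  by rewrite divr_gt0 ?exprn_gt0 ?mulr_gt0 ?subr_gt0.
by field; rewrite gt_eqF.
Qed.

Lemma arcoshK t : 1 <= t -> cosh (arcosh t) = t.
Proof.
move=> t1; rewrite /cosh /arcosh expRN.
have h : 0 <= t ^+ 2 - 1 by rewrite subr_ge0 expr_ge1 //; lra.
have := sqr_sqrtr h; have := sqrtr_ge0 (t ^+ 2 - 1).
set s := Num.sqrt _ => s0 es.
rewrite lnK ?posrE; last by lra.
have -> : (t + s)^-1 = t - s.
  have ts : t + s != 0 by rewrite gt_eqF //; lra.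
  by apply: (mulfI ts); rewrite divff //; lra.
lra.
Qed.

Lemma arcosh_ge0 t : 1 <= t -> 0 <= arcosh t.
Proof.
move=> t1; rewrite /arcosh ln_ge0 //.
by have := sqrtr_ge0 (t ^+ 2 - 1); lra.
Qed.

Lemma coshK t : 0 <= t -> arcosh (cosh t) = t.
Proof.
move=> t0; rewrite /arcosh /cosh expRN.
have e1 : 1 <= expR t by rewrite -expR0 ler_expR.
have e0 : expR t != 0 by rewrite gt_eqF ?expR_gt0.
have -> : ((expR t + (expR t)^-1) / 2) ^+ 2 - 1 = ((expR t - (expR t)^-1) / 2) ^+ 2.
  by field.
rewrite sqrtr_sqr ger0_norm.
  by rewrite (_ : _ + _ = expR t) ?expRK //; field.
by rewrite divr_ge0 // subr_ge0 (le_trans _ e1) // invf_le1 // expR_gt0.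
Qed.

Lemma le_arcosh s t : 1 <= s -> s <= t -> arcosh s <= arcosh t.
Proof.
move=> s1 st; have h : s ^+ 2 <= t ^+ 2 by rewrite ler_sqr ?nnegrE //; lra.
rewrite /arcosh ler_ln ?posrE ?lerD ?ler_sqrt ?lerB //.
- by rewrite subr_ge0 expr_ge1 //; lra.
- by have := sqrtr_ge0 (s ^+ 2 - 1); lra.
- by have := sqrtr_ge0 (t ^+ 2 - 1); lra.
Qed.

Lemma arcosh_le s t : 1 <= s -> 1 <= t -> arcosh s <= arcosh t -> s <= t.
Proof.
move=> s1 t1 st; rewrite leNgt; apply/negP => ts.
have /eqP : arcosh s == arcosh t by rewrite eq_le st; apply: le_arcosh => //; exact: ltW.
by move=> /(congr1 cosh); rewrite !arcoshK // => e; rewrite e ltxx in ts.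
Qed.

Lemma cosh_ge1 t : 0 <= t -> 1 <= cosh t.
Proof.
rewrite le_eqVlt => /orP[/eqP <-|/cosh_gt1/ltW //].
by rewrite /cosh oppr0 expR0; lra.
Qed.

Lemma hdistE p q : hplane p -> hplane q -> hdist p q = arcosh (mdot (hlift p) (hlift q)).
Proof.
move=> hp hq; rewrite /hdist mdot_hlift mdotC mdot_hlift mdotC mdot_homog.
rewrite sqrtrM ?ltW ?hplane_gt0 //; congr arcosh.
by field; rewrite !gt_eqF ?sqrt_hplane_gt0.
Qed.

Lemma mdot_hlift_ge1 p q : hplane p -> hplane q -> 1 <= mdot (hlift p) (hlift q).
Proof. by move=> hp hq; apply: hyperboloid_mdot_ge1; exact: hyperboloid_hlift. Qed.

Lemma hdist_ge0 p q : hplane p -> hplane q -> 0 <= hdist p q.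
Proof. by move=> hp hq; rewrite hdistE // arcosh_ge0 // mdot_hlift_ge1. Qed.

Lemma hdist_le p q t : hplane p -> hplane q -> 0 <= t ->
  (hdist p q <= t) = (mdot (hlift p) (hlift q) <= cosh t).
Proof.
move=> hp hq t0; rewrite hdistE // -{1}(coshK t0); apply/idP/idP => [|h].
  by apply: arcosh_le; [exact: mdot_hlift_ge1|exact: cosh_ge1].
by apply: le_arcosh => //; exact: mdot_hlift_ge1.
Qed.

Lemma hdist_cosh p q : hplane p -> hplane q ->
  mdot (hlift p) (hlift q) = cosh (hdist p q).
Proof. by move=> hp hq; rewrite hdistE // arcoshK // mdot_hlift_ge1. Qed.

(** The addition formula of the hyperbolic cosine; [Num.sqrt (x ^+ 2 - 1)] is the hyperbolic sine of
    [arcosh x]. *)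
Lemma arcoshD (x y c : R) : 1 <= x -> 1 <= y -> 1 <= c ->
  x * y + Num.sqrt (x ^+ 2 - 1) * Num.sqrt (y ^+ 2 - 1) = c ->
  arcosh x + arcosh y = arcosh c.
Proof.
move=> x1 y1 c1 <-; rewrite /arcosh.
have hx : 0 <= x ^+ 2 - 1 by rewrite subr_ge0 expr_ge1 //; lra.
have hy : 0 <= y ^+ 2 - 1 by rewrite subr_ge0 expr_ge1 //; lra.
have := sqr_sqrtr hx; have := sqrtr_ge0 (x ^+ 2 - 1).
have := sqr_sqrtr hy; have := sqrtr_ge0 (y ^+ 2 - 1).
set s := Num.sqrt (x ^+ 2 - 1); set r := Num.sqrt (y ^+ 2 - 1) => r0 er s0 es.
rewrite -lnM ?posrE; [|lra|lra].
(* The square root belonging to the sum is its hyperbolic sine, x r + s y. *)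
congr ln; rewrite (_ : _ - 1 = (x * r + s * y) ^+ 2).
  rewrite sqrtr_sqr ger0_norm; first by ring.
  by rewrite addr_ge0 // mulr_ge0 //; lra.
rewrite [LHS](_ : _ = x ^+ 2 * y ^+ 2 + 2 * x * y * s * r + s ^+ 2 * r ^+ 2 - 1);
  last by ring.
rewrite [RHS](_ : _ = x ^+ 2 * r ^+ 2 + 2 * x * y * s * r + s ^+ 2 * y ^+ 2);
  last by ring.
by rewrite es er; ring.
Qed.

(** Let [hlift z] = a P + b Q and c = <P,Q>. Since a^2 + 2abc + b^2 = 1, the hyperbolic sines of the
    distances from z to p and q are b and a times that of [hdist p q], and the addition formula
    applies. *)
Lemma hdist_conv p q t (z := ((1 - t) * p.1 + t * q.1, (1 - t) * p.2 + t * q.2)) :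
  hplane p -> hplane q -> 0 <= t <= 1 -> hdist p z + hdist q z = hdist p q.
Proof.
move=> hp hq t01; have hz : hplane z by exact: hplane_conv.
have lz := hlift_conv hp hq hz; rewrite -/z in lz.
move: lz; set a := (X in lin X); set b := (X in lin _ _ X) => lz.
have [t0 t1] := andP t01.
have a0 : 0 <= a by rewrite divr_ge0 ?mulr_ge0 ?sqrtr_ge0 ?subr_ge0.
have b0 : 0 <= b by rewrite divr_ge0 ?mulr_ge0 ?sqrtr_ge0.
have zz := (hyperboloid_hlift hz).1; have pp := (hyperboloid_hlift hp).1.
have qq := (hyperboloid_hlift hq).1.
have c1 := mdot_hlift_ge1 hp hq.
rewrite !hdistE //; apply: arcoshD => //; try exact: mdot_hlift_ge1.
move: zz; rewrite lz !mdotE pp qq (mdotC (hlift q)).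
move: c1; set c := mdot _ _ => c1 ab.
have e0 : 0 <= c ^+ 2 - 1 by rewrite subr_ge0 expr_ge1 //; lra.
have -> : (a * 1 + b * c) ^+ 2 - 1 = b ^+ 2 * (c ^+ 2 - 1).
  by rewrite -[X in _ - X]ab; ring.
have -> : (a * c + b * 1) ^+ 2 - 1 = a ^+ 2 * (c ^+ 2 - 1).
  by rewrite -[X in _ - X]ab; ring.
rewrite (sqrtrM _ (sqr_ge0 a)) (sqrtrM _ (sqr_ge0 b)) !sqrtr_sqr !ger0_norm //.
have es := sqr_sqrtr e0; move: es; set s := Num.sqrt _ => es.
rewrite -[RHS]mulr1 -[X in _ = _ * X]ab.
have -> : b * s * (a * s) = a * b * s ^+ 2 by ring.
rewrite es; ring.
Qed.

End Minkowski.

(** * Exit of a segment from a compact set *)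

Lemma interior_path (R : realType) (T : topologicalType) (K : set T)
    (g : R -> T) (t : R) : {for t, continuous g} -> interior K (g t) ->
  exists2 e, 0 < e & forall s, `|t - s| < e -> K (g s).
Proof.
move=> gt Kgt; have : nbhs t (g @^-1` K) by exact: gt.
by rewrite -nbhs_ballE => -[e /= e0 H]; exists e => // s; exact: H.
Qed.

Lemma continuous_affine_path (R : realType) (o v : R * R) :
  continuous (fun t : R => (o.1 + t * v.1, o.2 + t * v.2) : R * R).
Proof.
move=> t.
apply: (@cvg_pair _ _ _ _ (nbhs (o.1 + t * v.1)) (nbhs (o.2 + t * v.2)));
  apply: cvgD => /=;
  [exact: cvg_cst| |exact: cvg_cst|];
  by apply: cvgM; [exact: cvg_id|exact: cvg_cst].
Qed.

Lemma segment_exit (R : realType) (K : set (R * R)) (o z : R * R) :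
  compact K -> interior K o -> ~ K z ->
  exists2 t, 0 < t < 1 & bd K ((1 - t) * o.1 + t * z.1, (1 - t) * o.2 + t * z.2).
Proof.
move=> cK Ko Kz.
pose g (t : R) : R * R := ((1 - t) * o.1 + t * z.1, (1 - t) * o.2 + t * z.2).
have cg : continuous g.
  rewrite (_ : g = fun t => (o.1 + t * (z - o).1, o.2 + t * (z - o).2)).
    exact: continuous_affine_path.
  by apply/funext => t; rewrite /g /=; congr pair; ring.
have g0 : g 0 = o by rewrite /g (surjective_pairing o) /=; congr pair; ring.
have g1 : g 1 = z by rewrite /g (surjective_pairing z) /=; congr pair; ring.
have closedA : closed (g @^-1` K).
  apply: closed_comp => [t _|]; first exact: cg.
  by apply: compact_closed => //; exact: norm_hausdorff.
(* The exit point is the last point of the segment in K: past an interior point of K the segment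
   would continue in K. *)
have [|||t] := @compact_EVT_max _ R id (`[0, 1] `&` g @^-1` K).
- by exists 0; split; rewrite /= ?in_itv /= ?lexx ?ler01 // g0; exact: interior_subset.
- apply: subclosed_compact (@segment_compact R 0 1) _; last exact: subIsetl.
  by apply: closedI => //; exact: interval_closed.
- by apply: continuous_subspaceT => x; exact: cvg_id.
rewrite inE /= in_itv /= => -[/andP[t0 t1] Kgt] tmax.
have t1' : t < 1.
  by rewrite lt_neqAle t1 andbT; apply/eqP => e; apply: Kz; rewrite -g1 -e.
have nint : ~ interior K (g t).
  move=> /(interior_path (cg t))[e e0 H].
  pose s := Num.min 1 (t + e / 2).
  have ts : t < s by rewrite lt_min t1' /= ltrDl divr_gt0.
  suff : s <= t by rewrite leNgt ts.
  apply: tmax; rewrite inE /= in_itv /= ge_min lexx /= (le_trans t0 (ltW ts)).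
  split=> //; apply: H; rewrite ltr0_norm ?subr_lt0 // opprB.
  have : s <= t + e / 2 by rewrite /s ge_min lexx orbT.
  by lra.
exists t; last by split=> //; exact: subset_closure.
rewrite t1' andbT lt_neqAle t0 andbT; apply/eqP => e.
by apply: nint; rewrite -e g0.
Qed.

(** * Completeness and supporting lines of a body of constant diameter *)

Section ConstantDiameter.
Variables (R : realType) (K : set (R * R)) (d : R).
Hypothesis K_sub : K `<=` @hplane R.
Hypothesis K_compact : compact K.
Hypothesis K_interior : interior K !=set0.
Hypothesis d_gt0 : 0 < d.
Hypothesis K_diam : forall p q, K p -> K q -> mdot (hlift p) (hlift q) <= cosh d.
Hypothesis K_chord : forall p, bd K p ->
  exists2 q, K q & mdot (hlift p) (hlift q) = cosh d.

Local Notation C := (cosh d).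

Lemma cosh_diam_gt1 : 1 < C. Proof. exact: cosh_gt1. Qed.

(* If z were outside K, the segment from an interior point to z would leave K at
   a boundary point whose partner q contradicts the strict convexity of the
   distance to q. *)
Lemma diameter_complete z : hplane z ->
  (forall y, K y -> mdot (hlift z) (hlift y) <= C) -> K z.
Proof.
move=> hz Hz; apply: contrapT => Kz.
have [ o oK] := K_interior; have ho := K_sub (interior_subset oK).
have [t t01 bdp] := segment_exit K_compact oK Kz.
have [t0 t1] := andP t01.
have hp : hplane ((1 - t) * o.1 + t * z.1, (1 - t) * o.2 + t * z.2).
  by apply: hplane_conv => //; rewrite !ltW.
have [q Kq] := K_chord bdp.
have := (hyperboloid_hlift hp).1.
rewrite hlift_conv //.
set a := (X in lin X); set b := (X in lin _ _ X).
have a0 : 0 < a by rewrite divr_gt0 ?mulr_gt0 ?sqrt_hplane_gt0 ?subr_gt0.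
have b0 : 0 < b by rewrite divr_gt0 ?mulr_gt0 ?sqrt_hplane_gt0.
have oz : hlift o <> hlift z.
  move=> /(hlift_inj ho hz) oz; apply: Kz; rewrite -oz.
  exact: interior_subset.
have := hyperboloid_mdot_gt1 (hyperboloid_hlift ho) (hyperboloid_hlift hz) oz.
rewrite !mdotE (hyperboloid_hlift ho).1 (hyperboloid_hlift hz).1
  (mdotC (hlift z) (hlift o)).
set m := mdot _ _ => m1 ab e.
have h1 := Hz _ Kq. have h2 := K_diam (interior_subset oK) Kq.
have : a * mdot (hlift o) (hlift q) <= a * C by rewrite ler_pM2l.
have : b * mdot (hlift z) (hlift q) <= b * C by rewrite ler_pM2l.
(* As a^2 + 2abm + b^2 = 1 with m > 1, the coefficients have sum less than 1, so a combination of
   two products at most C cannot equal C. *)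
have abm : a * b < a * b * m by rewrite ltr_pMr // mulr_gt0.
have ab1 : a + b < 1.
  by rewrite -(@ltr_pXn2r _ 2) ?nnegrE ?addr_ge0 ?ltW // expr1n; lra.
have : (a + b) * C < C by rewrite gtr_pMl // (lt_trans ltr01) // cosh_diam_gt1.
lra.
Qed.

(** If z is in K it is a boundary point and has a partner; otherwise this is the contrapositive of
    [diameter_complete]. *)
Lemma far_point z : hplane z -> ~ interior K z ->
  exists2 x, K x & C <= mdot (hlift z) (hlift x).
Proof.
move=> hz iz; have [Kz|Kz] := pselect (K z).
  have [|q Kq <-] := K_chord (p := z); last by exists q.
  by split=> //; exact: subset_closure.
apply: contrapT => H; apply: Kz; apply: diameter_complete => // y Ky.
by rewrite leNgt; apply/negP => /ltW h; apply: H; exists y.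
Qed.

(* The points [lin 1 (hlift p) eta (homog X)] run through the line pX, on which
   the maximized function is constant. *)
Lemma support_point X : ideal X -> exists2 p, K p & forall eta,
  let v := lin 1 (hlift p) eta (homog X) in
  0 < v.1.1 -> ~ interior K (hproj v).
Proof.
move=> hX.
have den0 p : K p -> 0 < 1 - dot p X.
  by move=> /K_sub hp; rewrite -mdot_homog; exact: mdot_ideal.
(* The denominator is <X - p, X>, so [f p] is the slope of the chord from X through p relative to
   the diameter at X; a maximum leaves K on one side of that chord. *)
pose f (p : R * R) := (X.1 * p.2 - X.2 * p.1) / (1 - dot p X).
have [|||p] := @compact_EVT_max _ R f K.
- by have [ o oK] := K_interior; exists o; exact: interior_subset.
- exact: K_compact.
- apply: continuous_in_subspaceT => p; rewrite inE => Kp.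
  rewrite /f; apply: cvgM; first apply: cvgB.
  + by apply: cvgM; [exact: cvg_cst|exact: cvg_snd].
  + by apply: cvgM; [exact: cvg_cst|exact: cvg_fst].
  apply: cvgV; first by rewrite gt_eqF ?den0.
  apply: cvgB; first exact: cvg_cst.
  apply: cvgD.
  + by apply: cvgM; [exact: cvg_fst|exact: cvg_cst].
  + by apply: cvgM; [exact: cvg_snd|exact: cvg_cst].
rewrite inE => Kp pmax; exists p => // eta v v0 iv.
(* Moving orthogonally to X keeps the denominator of [f] and increases its numerator, which
   contradicts maximality. *)
have := @interior_path R _ K (fun t : R =>
  ((hproj v).1 + t * - X.2, (hproj v).2 + t * X.1)) 0.
rewrite !mul0r !addr0 -surjective_pairing => /(_ _ iv)[|e e0 H].
  exact: (@continuous_affine_path R (hproj v) (- X.2, X.1)  0).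
have /H Ks : `|0 - e / 2| < e.
  by rewrite sub0r normrN ger0_norm ?divr_ge0 ?ltW // ltr_pdivrMr //; lra.
have := pmax _ (mem_set Ks); rewrite {1}/f ler_pdivrMr ?den0 //.
set fp := f p => le1.
have Ep : X.1 * p.2 - X.2 * p.1 = fp * (1 - dot p X).
  by rewrite /fp /f divfK // gt_eqF ?den0.
have XX : X.1 * X.1 + X.2 * X.2 = 1 by exact: hX.
move: le1; rewrite leNgt => /negP; apply.
pose w := (hlift p).1.1.
have -> : dot ((hproj v).1 + e / 2 * - X.2, (hproj v).2 + e / 2 * X.1) X = dot (hproj v) X.
  by rewrite /dot /=; ring.
(* X is a null vector, so the term in [eta] drops out of the product with X. *)
have Ev : 1 - dot (hproj v) X = w / v.1.1 * (1 - dot p X).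
  have v1n : v.1.1 != 0 by rewrite gt_eqF.
  apply: (mulfI v1n); rewrite [RHS](_ : _ = w * (1 - dot p X)); last by field.
  transitivity (w * (1 - dot p X) + eta * (1 - (X.1 * X.1 + X.2 * X.2))).
    2: by rewrite XX subrr mulr0 addr0.
  by move: v1n; rewrite /v /w /dot /hproj /lin /=; set s := _^-1;
    rewrite !mul1r !mulr1 => v1n; field; exact: v1n.

have Nv : X.1 * (hproj v).2 - X.2 * (hproj v).1 = w / v.1.1 * (X.1 * p.2 - X.2 * p.1).
  have v1n : v.1.1 != 0 by rewrite gt_eqF.
  by move: v1n; rewrite /v /w /dot /hproj /lin /=; set s := _^-1;
    rewrite !mul1r !mulr1 => v1n; field; exact: v1n.
rewrite Ev mulrCA -Ep -Nv.
rewrite [X in _ < X](_ : _ = X.1 * (hproj v).2 - X.2 * (hproj v).1 +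
  e / 2 * (X.1 * X.1 + X.2 * X.2)); last by rewrite /=; ring.
by rewrite XX mulr1 ltrDl divr_gt0.
Qed.

(* For small e, a point of K at distance at least d from the point of parameter
   [sgn * e] satisfies both conclusions up to an error of order e. *)
Lemma support_partner X p sgn : ideal X -> K p -> sgn ^+ 2 = 1 ->
  (forall eta, let v := lin 1 (hlift p) eta (homog X) in
    0 < v.1.1 -> ~ interior K (hproj v)) ->
  exists2 q, K q & mdot (hlift p) (hlift q) = C /\
    0 <= sgn * (mdot (hlift q) (homog X) - C * mdot (hlift p) (homog X)).
Proof.
move=> hX Kp sgn2 supp; have hp := K_sub Kp; have C1 := cosh_diam_gt1.
pose n (x : R * R) := Num.sqrt (1 - dot x x).
pose b := mdot (hlift p) (homog X).
have b0 : 0 < b.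
  by rewrite /b mdot_hlift mulr_gt0 ?mdot_ideal // invr_gt0 sqrt_hplane_gt0.
have homogE x u : K x -> mdot (homog x) u = n x * mdot (hlift x) u.
  by move=> /K_sub hx; rewrite mdot_hlift mulVKf // gt_eqF ?sqrt_hplane_gt0.
(* On K, [f1 x] is n x (C - <p,x>) >= 0 and [f2 x] is n x sgn (C <p,X> - <x,X>); a point where both
   are at most 0 is sought. The factor [n] turns lifts into [homog], which makes both continuous on
   the whole plane. *)
pose f1 (x : R * R) := C * n x - mdot (homog x) (hlift p).
pose f2 (x : R * R) := sgn * (C * b * n x - mdot (homog x) (homog X)).
have f1_ge0 x : K x -> 0 <= f1 x.
  move=> Kx; rewrite /f1 homogE // mulrC -mulrBr mulr_ge0 ?sqrtr_ge0 //.
  by rewrite subr_ge0 K_diam.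
have cn : continuous n.
  move=> x; apply: continuous_comp; last exact: sqrt_continuous.
  apply: cvgB; first exact: cvg_cst.
  by apply: cvgD; apply: cvgM; (exact: cvg_fst || exact: cvg_snd).
have cm u : continuous (fun x => mdot (homog x) u).
  move=> x; apply: cvgB; first apply: cvgB; apply: cvgM => /=;
    (exact: cvg_cst || exact: cvg_fst || exact: cvg_snd).
have [|||q] := @compact_EVT_min _ R (f1 \max f2) K.
- by exists p.
- exact: K_compact.
- apply: continuous_subspaceT => x; apply: continuous_max.
    by apply: cvgB; [apply: cvgM; [exact: cvg_cst|exact: cn]|exact: cm].
  by apply: cvgM; [exact: cvg_cst|apply: cvgB;
    [apply: cvgM; [exact: cvg_cst|exact: cn]|exact: cm]].
rewrite inE => Kq qmin.
have sb : `|sgn| = 1.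
  by apply/eqP; rewrite -(@eqrXn2 _ 2) ?expr1n // real_normK ?num_real // sgn2.
(* The terms [2 + 2 * C * b] control the error of [f1], and [2 * C * b ^+ 2] that of [f2]. *)
pose M := 2 + 2 * C * b + 2 * C * b ^+ 2.
have M0 : 0 < M.
  have : 0 < C * b by rewrite mulr_gt0 //; lra.
  have : 0 < C * b ^+ 2 by rewrite mulr_gt0 ?exprn_gt0 //; lra.
  by rewrite /M; lra.
have small (e : R) : 0 < e -> e * b <= 1 / 4 -> Num.max (f1 q) (f2 q) <= e * M.
  move=> e0 eb.
  pose v := lin 1 (hlift p) (sgn * e) (homog X).
  have [hp1 hp0] := hyperboloid_hlift hp.
  pose u := sgn * e * b.
  have eb0 : 0 < e * b by rewrite mulr_gt0.
  have uE : `|u| = e * b by rewrite /u !normrM sb mul1r !gtr0_norm.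
  have u2 : u ^+ 2 = (e * b) ^+ 2 by rewrite -uE real_normK ?num_real.
  have /ler_normlP[u_ge u_le] : `|u| <= e * b by rewrite uE.
  have vv : mdot v v = 1 + 2 * u.
    rewrite !mdotE hp1 (mdotC (homog X) (hlift p)) -/b mdot_homog.
    by rewrite (_ : dot X X = 1) // subrr /u; ring.
  have pv : mdot (hlift p) v = 1 + u by rewrite mdotE hp1 -/b /u; ring.
  pose w := Num.sqrt (mdot v v).
  have vv0 : 0 < mdot v v by rewrite vv; lra.
  have w0 : 0 < w by rewrite sqrtr_gt0.
  (* A second-order bound for sqrt (1 + 2u), valid as |u| <= 1/4: the estimate of [f2] is divided by
     [e], so the linear terms have to match exactly. *)
  have w_ge : 1 + u - 2 * u ^+ 2 <= w.
    rewrite leNgt; apply/negP => lt_w.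
    have : w ^+ 2 < (1 + u - 2 * u ^+ 2) ^+ 2.
      by rewrite ltr_pXn2r // nnegrE ltW // (lt_trans w0).
    rewrite sqr_sqrtr ?ltW // vv ltNge => /negP; apply.
    rewrite -subr_ge0 (_ : _ - _ = u ^+ 2 * ((1 + 2 * u) * (3 - 2 * u))); last by ring.
    by rewrite mulr_ge0 ?sqr_ge0 // mulr_ge0 //; lra.
  have hV : hyperboloid (lin w^-1 v 0 v).
    by apply: (hyperboloid_unit (hyperboloid_hlift hp)) => //; rewrite pv; lra.
  have v0 : 0 < v.1.1.
    by apply: (future (hyperboloid_hlift hp)) => //; rewrite pv; lra.
  have VE : hproj (lin w^-1 v 0 v) = hproj v.
    by rewrite /hproj; move: v0; case: (v) => [[y0 y1] y2] /= y0_gt0;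
      congr pair; field; rewrite ?gt_eqF.
  have [||x Kx] := @far_point (hproj v).
  - by rewrite -VE; exact: hplane_hproj.
  - exact: supp.
  rewrite -VE hlift_hproj // mdotE mul0r addr0 ler_pdivlMl // => le_w.
  have hx := K_sub Kx.
  have nx : 0 < n x by rewrite sqrt_hplane_gt0.
  have nx1 : n x <= 1.
    rewrite -sqrtr1 ler_sqrt // gerBl /dot.
    by rewrite addr_ge0 // -expr2 sqr_ge0.
  pose xi := mdot (homog x) (homog X).
  have xi0 : 0 < xi by exact: mdot_ideal.
  have xi2 : xi <= 2.
    have : dot X X = 1 by exact: hX.
    have := hplane_gt0 hx; have := sqr_ge0 (x.1 + X.1); have := sqr_ge0 (x.2 + X.2).
    by rewrite /xi mdot_homog /dot; lra.
  have le1 : n x * (w * C) <= mdot (homog x) (hlift p) + sgn * e * xi.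
    rewrite /xi !homogE // [X in _ <= _ + X]mulrCA -mulrDr ler_pM2l //.
    by apply: le_trans le_w _; rewrite mdotE mul1r !(mdotC _ (hlift x)).
  have le2 : mdot (homog x) (hlift p) <= n x * C by rewrite homogE // ler_pM2l // K_diam.
  have le3 : n x * C * (1 + u - 2 * u ^+ 2) <= n x * C * w.
    by rewrite ler_wpM2l // mulr_ge0 ?ltW //; lra.
  have sgn_le : sgn * e * xi <= e * 2.
    apply: le_trans (ler_norm _) _; rewrite !normrM sb mul1r !gtr0_norm //.
    by rewrite ler_pM2l.
  have Cn : n x * C <= C by rewrite ler_piMl //; lra.
  have Cn0 : 0 < n x * C by rewrite mulr_gt0 //; lra.
  have eb2 : (e * b) ^+ 2 <= e * b * (1 / 4) by rewrite expr2 ler_pM2l.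
  have le4 : n x * C * (- u + 2 * u ^+ 2) <= C * (2 * (e * b)).
    have : n x * C * (- u + 2 * u ^+ 2) <= n x * C * (2 * (e * b)).
      by rewrite ler_pM2l // u2; lra.
    have : n x * C * (2 * (e * b)) <= C * (2 * (e * b)) by rewrite ler_wpM2r //; lra.
    lra.
  have le5 : n x * C * u ^+ 2 <= C * (e * b) ^+ 2 by rewrite u2 ler_wpM2r ?sqr_ge0.
  have Cb0 : 0 <= e * (C * b ^+ 2) by rewrite mulr_ge0 ?mulr_ge0 ?sqr_ge0 //; lra.
  have Cb1 : 0 <= e * (C * b) by rewrite mulr_ge0 ?mulr_ge0 //; lra.
  have f1x : f1 x <= e * M.
    rewrite /f1 /M.
    have : C * n x - mdot (homog x) (hlift p) <=
      n x * C * (- u + 2 * u ^+ 2) + sgn * e * xi by lra.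
    lra.
  have f2x : f2 x <= e * M.
    rewrite -(ler_pM2l e0).
    have : e * f2 x = n x * C * u - sgn * e * xi by rewrite /f2 /u -/xi; ring.
    have : e * (2 * C * b ^+ 2 * e) <= e * (e * M).
      rewrite ler_pM2l // mulrC ler_pM2l // /M.
      have : 0 < C * b by rewrite mulr_gt0 //; lra.
      lra.
    clearbody xi; lra.
  by apply: le_trans (qmin _ (mem_set Kx)) _; rewrite /= ge_max f1x.
have m0 : Num.max (f1 q) (f2 q) <= 0.
  rewrite leNgt; apply/negP => m0; set m := Num.max _ _ in small m0 *.
  (* The bound in [small] holds for a number independent of [e]: the first entry meets its
     hypothesis, and the second turns it into m <= m / 2. *)
  pose e : R := Num.min (1 / (4 * b)) (m / (2 * M)).
  have e0 : 0 < e by rewrite lt_min !divr_gt0 ?mulr_gt0.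
  have e1 : e <= 1 / (4 * b) by rewrite ge_min lexx.
  have e2 : e <= m / (2 * M) by rewrite ge_min lexx orbT.
  have : m <= e * M.
    apply: small => //; rewrite -ler_pdivlMr // (le_trans e1) //.
    by rewrite [X in X <= _](_ : _ = 1 / 4 / b) //; field; rewrite gt_eqF.
  have : e * M <= m / 2.
    rewrite -ler_pdivlMr // (le_trans e2) //.
    by rewrite [X in X <= _](_ : _ = m / 2 / M) //; field; rewrite gt_eqF.
  lra.
move: m0; rewrite ge_max => /andP[f1q f2q].
have nq : 0 < n q by rewrite sqrt_hplane_gt0 //; exact: K_sub.
exists q => //; split.
  have /eqP : f1 q = 0 by apply/eqP; rewrite eq_le f1q f1_ge0.
  rewrite /f1 homogE // mulrC -mulrBr mulf_eq0 gt_eqF //= subr_eq0 mdotC.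
  by move=> /eqP.
move: f2q; rewrite /f2 homogE // (_ : _ * _ =
  - (n q * (sgn * (mdot (hlift q) (homog X) - C * b)))); last by ring.
by rewrite oppr_le0 pmulr_rge0.
Qed.

(* With Q the convex combination of the lifts of q1 and q2 such that
   <Q,X> = C <p,X>, the point sought is r = s Q - (s - 1) C P with s >= 1 making
   r a unit vector: then <r,P> = C, and <r,Y> <= s C - (s - 1) C = C for Y in K
   because <P,Y> >= 1. *)
Lemma support_normal X p : ideal X -> K p ->
  (forall eta, let v := lin 1 (hlift p) eta (homog X) in
    0 < v.1.1 -> ~ interior K (hproj v)) ->
  exists2 r, K r & mdot (hlift r) (hlift p) = C /\
    mdot (hlift r) (homog X) = C * mdot (hlift p) (homog X).
Proof.
move=> hX Kp supp; have C1 := cosh_diam_gt1.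
have [q1 Kq1 [pq1]] := support_partner hX Kp (expr1n _ 2) supp.
rewrite mul1r subr_ge0.
have [q2 Kq2 [pq2]] := support_partner hX Kp (sqrr_sign _ 1) supp.
rewrite expr1 mulN1r oppr_ge0 subr_le0.
set b := mdot (hlift p) (homog X); set b1 := mdot (hlift q1) _.
set b2 := mdot _ _ => b2C Cb1.
have [t t01 bt] : exists2 t, 0 <= t <= 1 & (1 - t) * b1 + t * b2 = C * b.
  have [e|ne] := eqVneq b1 b2.
    by exists 0; rewrite ?lexx ?ler01 //; lra.
  have lt21 : b2 < b1 by rewrite lt_neqAle eq_sym ne /=; lra.
  exists ((b1 - C * b) / (b1 - b2)).
    apply/andP; split; first by rewrite divr_ge0 ?subr_ge0 ?(ltW lt21).
    by rewrite ler_pdivrMr ?subr_gt0 //; lra.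
  by field; rewrite subr_eq0.
have hp := K_sub Kp; have hq1 := K_sub Kq1; have hq2 := K_sub Kq2.
have [t0 t1] := andP t01.
pose Q := lin (1 - t) (hlift q1) t (hlift q2).
pose M := mdot Q Q.
have [M1 MC] : 1 <= M /\ M < C ^+ 2.
  rewrite /M /Q !mdotE (hyperboloid_hlift hq1).1 (hyperboloid_hlift hq2).1.
  rewrite (mdotC (hlift q2)).
  have := mdot_hlift_ge1 hq1 hq2; have := K_diam Kq1 Kq2.
  set g := mdot _ _ => gC g1.
  (* Here M = 1 + 2t(1-t)(g-1), which is at most (C+1)/2 because 4t(1-t) <= 1. *)
  have h : 0 <= t * (1 - t) by rewrite mulr_ge0 // subr_ge0.
  have h1 : 0 <= t * (1 - t) * (g - 1) by rewrite mulr_ge0 // subr_ge0.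
  have h2 : 0 <= t * (1 - t) * (C - g) by rewrite mulr_ge0 // subr_ge0.
  have h3 : 0 <= (t - 1 / 2) ^+ 2 * (C - 1) by rewrite mulr_ge0 ?sqr_ge0 //; lra.
  have h4 : 0 < (C - 1) * (C - 1) by rewrite mulr_gt0 //; lra.
  split; lra.
have QP : mdot Q (hlift p) = C by rewrite /Q mdotE !(mdotC _ (hlift p)) pq1 pq2; ring.
have QX : mdot Q (homog X) = C * b by rewrite /Q mdotE.
have QK y : K y -> mdot Q (hlift y) <= C.
  move=> Ky; rewrite /Q mdotE.
  have l1 : (1 - t) * mdot (hlift q1) (hlift y) <= (1 - t) * C.
    by rewrite ler_wpM2l ?subr_ge0 ?K_diam.
  have l2 : t * mdot (hlift q2) (hlift y) <= t * C by rewrite ler_wpM2l ?K_diam.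
  lra.
rewrite -/M in M1 MC; clearbody Q.
(* Since <Q,P> = C, the vector r has <r,r> = C^2 - s^2 (C^2 - M), and this is 1 for the chosen s. *)
pose s := Num.sqrt ((C ^+ 2 - 1) / (C ^+ 2 - M)).
have s2 : s ^+ 2 * (C ^+ 2 - M) = C ^+ 2 - 1.
  by rewrite sqr_sqrtr ?divfK ?divr_ge0 ?gt_eqF //; lra.
have s1 : 1 <= s.
  have s2_ge1 : 1 <= (C ^+ 2 - 1) / (C ^+ 2 - M).
    by rewrite ler_pdivlMr ?mul1r; lra.
  by rewrite -sqrtr1 ler_sqrt //; exact: le_trans ler01 _.
pose r := lin s Q (- ((s - 1) * C)) (hlift p).
have [pp p0] := hyperboloid_hlift hp.
have rr : mdot r r = 1.
  rewrite /r !mdotE pp (mdotC (hlift p) Q) QP -/M.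
  rewrite [LHS](_ : _ = C ^+ 2 - s ^+ 2 * (C ^+ 2 - M)); first by rewrite s2; ring.
  by ring.
have rp : mdot r (hlift p) = C by rewrite /r mdotE QP pp; ring.
have hr : hyperboloid r.
  split=> //; apply: (future (hyperboloid_hlift hp)); first by rewrite rr.
  by rewrite mdotC rp; lra.
exists (hproj r); rewrite ?hlift_hproj //; last first.
  by split => //; rewrite /r mdotE -/b QX; ring.
apply: diameter_complete; first exact: hplane_hproj.
move=> y Ky; rewrite hlift_hproj // /r mdotE.
have l1 : (s - 1) * C * 1 <= (s - 1) * C * mdot (hlift p) (hlift y).
  rewrite ler_wpM2l ?mdot_hlift_ge1 //; last exact: K_sub.
  by rewrite mulr_ge0 //; lra.
have : s * mdot Q (hlift y) <= s * C.
  by rewrite ler_wpM2l ?QK //; lra.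
lra.
Qed.

End ConstantDiameter.

(** * Chords through an ideal point and their normals *)

Lemma ideal_chord (R : realType) (X p : R * R) : ideal X -> hplane p ->
  exists2 Y, ideal Y /\ Y <> X & hline Y X p /\
    forall r, side Y X r = 0 ->
      exists s, r = (X.1 + s * (p.1 - X.1), X.2 + s * (p.2 - X.2)).
Proof.
case: X p => [x1 x2] [p1 p2]; rewrite /ideal /hplane /hline /dot /side /= => hX hp.
have D0 : 0 < (p1 - x1) ^+ 2 + (p2 - x2) ^+ 2.
  have := sqr_ge0 (p1 - x1); have := sqr_ge0 (p2 - x2).
  move: (p1 - x1) (p2 - x2) (subrK x1 p1) (subrK x2 p2) => a b ea eb.
  rewrite -ea -eb in hp => b0 a0; rewrite lt_neqAle addr_ge0 // andbT.
  apply/eqP => ab; have /eqP : a ^+ 2 = 0 by lra.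
  have /eqP : b ^+ 2 = 0 by lra.
  by rewrite !sqrf_eq0 => /eqP b0' /eqP a0'; subst; lra.
(* [k] is the nonzero root of |X + k (p - X)|^2 = 1, so Y is the second end of the chord through X
   and p. *)
set D := (X in 0 < X) in D0; pose k := 2 * (1 - (p1 * x1 + p2 * x2)) / D.
have k0 : 0 < k by rewrite divr_gt0 // mulr_gt0 //; rewrite /D in D0; lra.
have kD : k * D = 2 * (1 - (p1 * x1 + p2 * x2)) by rewrite divfK // gt_eqF.
exists (x1 + k * (p1 - x1), x2 + k * (p2 - x2)) => /=; split.
- rewrite [LHS](_ : _ = (x1 * x1 + x2 * x2) + k * (k * D) +
    2 * k * (p1 * x1 + p2 * x2 - (x1 * x1 + x2 * x2))); last by rewrite /D; ring.
  by rewrite kD hX; ring.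
- move=> [e1 e2]; have /eqP : k ^+ 2 * D = 0.
    rewrite [LHS](_ : _ = (x1 + k * (p1 - x1) - x1) ^+ 2 +
      (x2 + k * (p2 - x2) - x2) ^+ 2); first by rewrite e1 e2; ring.
    by rewrite /D; ring.
  by rewrite mulf_eq0 expf_eq0 /= !gt_eqF.
- by split=> //; ring.
- case=> [r1 r2] /= h.
  have /eqP : k * ((p1 - x1) * (r2 - x2) - (p2 - x2) * (r1 - x1)) = 0.
    by rewrite -[RHS]oppr0 -h; ring.
  rewrite mulf_eq0 gt_eqF //= => /eqP h'.
  exists (((r1 - x1) * (p1 - x1) + (r2 - x2) * (p2 - x2)) / D).
  have Dn : D != 0 by rewrite gt_eqF.
  congr pair; apply: (mulfI Dn).
  + rewrite [RHS](_ : _ = D * r1 + (p2 - x2) *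
      ((p1 - x1) * (r2 - x2) - (p2 - x2) * (r1 - x1))).
      by rewrite h' mulr0 addr0.
    by rewrite /D; field.
  + rewrite [RHS](_ : _ = D * r2 - (p1 - x1) *
      ((p1 - x1) * (r2 - x2) - (p2 - x2) * (r1 - x1))).
      by rewrite h' mulr0 subr0.
    by rewrite /D; field.
Qed.

(** [homog q] is a combination of [homog p] and [homog X], and on both of these the product with r
    is C times the product with p. Hence <r,q> = C <p,q>, the hyperbolic Pythagorean theorem for the
    foot p. *)
Lemma mdot_normal_line (R : realType) (C : R) (X p r q : R * R) s :
  0 <= C -> hplane p -> hplane q ->
  mdot (hlift r) (hlift p) = C ->
  mdot (hlift r) (homog X) = C * mdot (hlift p) (homog X) ->
  q = (X.1 + s * (p.1 - X.1), X.2 + s * (p.2 - X.2)) ->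
  C <= mdot (hlift r) (hlift q).
Proof.
move=> C0 hp hq rp rX qE.
have [n0 [hn0 np]] : exists n, 0 < n /\ homog p = lin n (hlift p) 0 (hlift p).
  have := sqrt_hplane_gt0 hp; rewrite /homog /lin /hlift /=; set m := Num.sqrt _ => m0.
  by exists m; split=> //; congr (_, _, _); field; rewrite gt_eqF.
have qh : homog q = lin s (homog p) (1 - s) (homog X).
  by rewrite qE /lin /homog /=; congr (_, _, _); ring.
have -> : mdot (hlift r) (hlift q) = C * mdot (hlift p) (hlift q).
  rewrite !(mdotC _ (hlift q)) !mdot_hlift mulrCA; congr (_ * _).
  by rewrite qh np !mdotE !(mdotC (homog X)) rX
    (mdotC (hlift p) (hlift r)) rp (hyperboloid_hlift hp).1; ring.
by rewrite ler_peMr // mdot_hlift_ge1.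
Qed.

(** * Upper and lower bounds for the strip of a line *)

Section Strip.
Variables (R : realType) (K : set (R * R)) (d : R) (Y X : R * R).
Hypothesis K_sub : K `<=` @hplane R.
Hypothesis K_diam : forall p q, K p -> K q -> hdist p q <= d.
Hypothesis meet : hline Y X `&` K !=set0.

Lemma dist_to_le p z : hplane p -> hline Y X z -> dist_to (hline Y X) p <= hdist p z.
Proof.
move=> hp Lz; apply: ge_inf; last by exists z.
by exists 0 => _ [q [hq _] <-]; exact: hdist_ge0.
Qed.

Lemma dist_to_ge0 p : hplane p -> 0 <= dist_to (hline Y X) p.
Proof.
move=> hp; apply: lb_le_inf.
  by have [z [Lz _]] := meet; exists (hdist p z); exists z.
by move=> _ [q [hq _] <-]; exact: hdist_ge0.
Qed.

Lemma dist_to_add p q : K p -> K q -> 0 <= side Y X p -> side Y X q <= 0 ->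
  dist_to (hline Y X) p + dist_to (hline Y X) q <= d.
Proof.
move=> Kp Kq; have hp := K_sub Kp; have hq := K_sub Kq.
set a := side Y X p; set b := side Y X q => a0 b0.
(* [side] is affine along pq and vanishes at a / (a - b); if a = b, both are 0 and any t serves. *)
have [t t01 et] : exists2 t, 0 <= t <= 1 & (1 - t) * a + t * b = 0.
  have [e|ne] := eqVneq a b.
    by exists 0; rewrite ?lexx ?ler01 //; lra.
  have lt21 : b < a by rewrite lt_neqAle eq_sym ne /=; lra.
  exists (a / (a - b)).
    apply/andP; split; first by rewrite divr_ge0 // subr_ge0 ltW.
    by rewrite ler_pdivrMr ?subr_gt0 //; lra.
  by field; rewrite subr_eq0.
have hz := hplane_conv hp hq t01.
have Lz : hline Y X ((1 - t) * p.1 + t * q.1, (1 - t) * p.2 + t * q.2).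
  by split=> //; rewrite -et /a /b /side /=; ring.
apply: le_trans (K_diam Kp Kq).
by rewrite -(hdist_conv hp hq t01) lerD // dist_to_le.
Qed.

Let plus := [set dist_to (hline Y X) p | p in K `&` halfplane_plus Y X].
Let minus := [set dist_to (hline Y X) p | p in K `&` halfplane_minus Y X].

(** A common point of the line and K lies in both closed half-planes, so neither supremum is over
    the empty set. *)
Let plus0 : plus !=set0.
Proof.
have [z [[hz sz] Kz]] := meet; exists (dist_to (hline Y X) z); exists z => //.
by split=> //; split=> //; rewrite sz.
Qed.

Let minus0 : minus !=set0.
Proof.
have [z [[hz sz] Kz]] := meet; exists (dist_to (hline Y X) z); exists z => //.
by split=> //; split=> //; rewrite sz.
Qed.

Let add_le a b : plus a -> minus b -> a + b <= d.
Proof.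
by move=> [p [Kp [_ sp]] <-] [q [Kq [_ sq]] <-]; exact: dist_to_add.
Qed.

Let ge0_plus a : plus a -> 0 <= a.
Proof. by move=> [p [Kp _] <-]; apply: dist_to_ge0; exact: K_sub. Qed.

Let ge0_minus a : minus a -> 0 <= a.
Proof. by move=> [p [Kp _] <-]; apply: dist_to_ge0; exact: K_sub. Qed.

Lemma d_strip_le : d_strip K Y X <= d.
Proof.
rewrite /d_strip -lerBrDr; apply: ge_sup => // a pa.
rewrite lerBrDl -lerBrDr; apply: ge_sup => // b mb.
by rewrite lerBrDl add_le.
Qed.

(** The point [r] makes the supremum on its own side at least d, and the other one is
    nonnegative. *)
Lemma d_strip_ge r : K r -> (forall q, hline Y X q -> d <= hdist r q) ->
  d <= d_strip K Y X.
Proof.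
move=> Kr far; have hr := K_sub Kr.
have dr : d <= dist_to (hline Y X) r.
  apply: lb_le_inf => [|_ [q Lq <-]]; last exact: far.
  by have [z [Lz _]] := meet; exists (hdist r z); exists z.
have [a pa] := plus0; have [b mb] := minus0.
(* [sup] is 0 on unbounded sets, so bounds are required: adding a nonnegative element of the other
   side shows that d is one. *)
have ubp : has_ubound plus.
  by exists d => c pc; rewrite (le_trans _ (add_le pc mb)) // lerDl ge0_minus.
have ubm : has_ubound minus.
  by exists d => c mc; rewrite (le_trans _ (add_le pa mc)) // lerDr ge0_plus.
have dp : 0 <= d_plus K Y X by apply: le_trans (ge0_plus pa) _; exact: ub_le_sup.
have dm : 0 <= d_minus K Y X by apply: le_trans (ge0_minus mb) _; exact: ub_le_sup.
rewrite /d_strip (le_trans dr) //.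
have [sr|/ltW sr] := leP 0 (side Y X r).
  by rewrite -[leLHS]addr0 lerD //; apply: ub_le_sup => //; exists r.
by rewrite -[leLHS]add0r lerD //; apply: ub_le_sup => //; exists r.
Qed.

End Strip.

(** * From constant diameter to constant width *)

(** A positive [diameter K] cannot be the default value 0, so the set of distances is bounded. *)
Lemma hdist_le_diameter (R : realType) (K : set (R * R)) p q :
  0 < diameter K -> K p -> K q -> hdist p q <= diameter K.
Proof.
move=> D0 Kp Kq; apply: ub_le_sup; last by exists (p, q).
apply: contrapT => nub; move: D0; rewrite /diameter sup_out ?ltxx //.
by move=> [_].
Qed.

Unset Implicit Arguments.

Theorem theorem1 (R : realType) (K : set (R * R)) (d : R) :
  convex_body K -> 0 < d -> constant_diameter K d -> constant_width K d.
Proof.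
move=> [K_sub cK _ iK] d0 [dK chord] X hX.
have Kd p q : K p -> K q -> hdist p q <= d.
  by rewrite -dK => Kp Kq; apply: hdist_le_diameter; rewrite ?dK.
have clK : closure K `<=` K.
  have /closure_id <- // : closed K.
  by apply: compact_closed => //; exact: norm_hausdorff.
have Kcosh p q : K p -> K q -> mdot (hlift p) (hlift q) <= cosh d.
  by move=> Kp Kq; rewrite -hdist_le; [exact: Kd|exact: K_sub|exact: K_sub|exact: ltW].
have Kchord p : bd K p -> exists2 q, K q & mdot (hlift p) (hlift q) = cosh d.
  move=> bp; have [q [/clK Kq _] pq] := chord _ bp; exists q => //.
  by rewrite hdist_cosh ?pq //; apply: K_sub => //; apply: clK; case: bp.
have [p Kp supp] := support_point K_sub cK iK hX.
have [r Kr [rp rX]] := support_normal K_sub cK iK d0 Kcosh Kchord hX Kp supp.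
have [Y [hY YX] [Lp Lr]] := ideal_chord hX (K_sub _ Kp).
have meet : hline Y X `&` K !=set0 by exists p.
have strip_le Z : hline Z X `&` K !=set0 -> d_strip K Z X <= d.
  exact: d_strip_le.
have strip_ge : d <= d_strip K Y X.
  apply: (d_strip_ge K_sub Kd meet Kr) => q [hq /Lr[s qE]].
  rewrite hdistE //; last exact: K_sub.
  rewrite -(coshK (ltW d0)); apply: le_arcosh; first exact/ltW/cosh_gt1.
  apply: (mdot_normal_line _ (K_sub _ Kp) hq rp rX qE).
  by rewrite (le_trans ler01) // ltW // cosh_gt1.
(* All lines through X that meet K have strips of width at most d, and the line pX attains d. *)
apply/eqP; rewrite eq_le; apply/andP; split.
  apply: ge_sup; first by exists (d_strip K Y X); exists Y.
  by move=> _ [Z [_ _ ZK] <-]; exact: strip_le.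
apply: le_trans strip_ge _; apply: ub_le_sup; last by exists Y.
by exists d => _ [Z [_ _ ZK] <-]; exact: strip_le.
Qed.
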